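(* Let $\mathcal{G}$ be a rooted graph of bounded degree, with maximum degree $\Delta\ge2$, and let $d$ be a metric on the vertices of $\mathcal{G}$ such that $d(u,v)\le1$ for any neighbouring vertices $u$ and $v$. If $\theta\in[0,1]$ satisfies $\theta\le\frac1{(\Delta-1)e}$, then there is almost surely no Rough Mount Fuji accessibility percolation on $\mathcal{G}$. In particular, for any $n\ge2$ and any $q\in[1,\infty]$, there is almost surely no Rough Mount Fuji accessibility percolation on the $n$-dimensional lattice $\mathbb{Z}^n$ with the $\ell^q$ distance: (i) with non-backtracking paths, when $\theta\le\frac1{ne}$; (ii) with all (simple) paths, when $\theta\le\frac1{(2n-1)e}$. Thus $\theta_c\ge\frac1{ne}$ in the non-backtracking case, and $\theta_c\ge\frac1{(2n-1)e}$ otherwise.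
   Context: Rough Mount Fuji (RMF) labels: for a connected rooted graph with vertex set $V$, root $\rho$, a metric $d$ on $V$ and $\theta\in[0,1]$, let $\{U_v:v\in V\}$ be i.i.d. Uniform$(0,1)$ and set $X_v=U_v+\theta\,d(\rho,v)$. A simple path $\rho=v_0,v_1,\ldots$ is increasing if $X_{v_0}<X_{v_1}<\cdots$. RMF accessibility percolation is the event that there exists an infinite increasing simple path from $\rho$ (among permitted paths, if there is a restriction). On $\mathbb{Z}^n$ (nearest-neighbour edges, root $0$, $d(x,y)=\|x-y\|_q$), two choices of permitted paths are considered: all simple paths from $0$; or only non-backtracking paths, i.e. simple paths $x_0=0,x_1,\ldots$ where each step moves further from the origin in the graph ($\ell^1$) distance, $\|x_{j+1}\|_1>\|x_j\|_1$ for each $j$ (for $q<\infty$ equivalently $d(0,x_{j+1})>d(0,x_j)$). In each case $\theta_c=\inf\{\theta\in[0,1]:\mathbb{P}_\theta(\text{RMF accessibility percolation})>0\}$. *)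

(* Defs.v *)
From HB Require Import structures.
From mathcomp Require Import all_boot all_order all_algebra finmap.
From mathcomp Require Import all_classical all_reals all_analysis.

Set Implicit Arguments.
Unset Strict Implicit.
Unset Printing Implicit Defensive.

Import Order.TTheory GRing.Theory Num.Theory.
Import numFieldNormedType.Exports.

Local Open Scope classical_set_scope.
Local Open Scope card_scope.
Local Open Scope ring_scope.

Definition connected_graph (V : choiceType) (adj : rel V) : Prop :=
  [/\ symmetric adj, irreflexive adj &
      forall x y : V, exists2 p : seq V, path adj x p & last x p = y].

Definition has_max_degree (V : choiceType) (adj : rel V) (Delta : nat) : Prop :=
  (forall v : V, [set u | adj v u] #<= `I_Delta) /\
  (exists v : V, [set u | adj v u] #= `I_Delta).

Definition simple_ray (V : choiceType) (adj : rel V) (rho : V) :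
    set (nat -> V) :=
  [set x | [/\ x 0%N = rho, forall j, adj (x j) (x j.+1) & injective x]].

(* The equality of laws is only required on measurable sets: off the
   sigma-algebra the underlying set functions carry no meaning. *)
Definition uniform01 (R : realType) (dsp : measure_display)
    (Omega : measurableType dsp) (P : probability Omega R)
    (X : {RV P >-> R}) : Prop :=
  forall A : set R, measurable A ->
    distribution P X A = uniform_prob (@ltr01 R) A.

Definition independent_family (R : realType) (dsp : measure_display)
    (Omega : measurableType dsp) (P : probability Omega R)
    (I : choiceType) (X : I -> {RV P >-> R}) : Prop :=
  forall (F : {fset I}) (A : I -> set R), (forall i, measurable (A i)) ->
    P (\bigcap_(i in [set` F]) (X i @^-1` A i)) =
    (\prod_(i <- F) P (X i @^-1` A i))%E.

Definition iid_uniform01 (R : realType) (dsp : measure_display)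
    (Omega : measurableType dsp) (P : probability Omega R)
    (V : choiceType) (U : V -> {RV P >-> R}) : Prop :=
  independent_family U /\ forall v, uniform01 (U v).

Definition rmf_label (R : realType) (dsp : measure_display)
    (Omega : measurableType dsp) (P : probability Omega R)
    (V : choiceType) (rho : V) (dist : V -> V -> R)
    (U : V -> {RV P >-> R}) (theta : R) (v : V) (w : Omega) : R :=
  U v w + theta * dist rho v.

(* [permitted] is the set of permitted infinite paths from [rho]. *)
Definition rmf_percolation (R : realType) (dsp : measure_display)
    (Omega : measurableType dsp) (P : probability Omega R)
    (V : choiceType) (rho : V) (dist : V -> V -> R)
    (permitted : set (nat -> V))
    (U : V -> {RV P >-> R}) (theta : R) : set Omega :=
  [set w | exists2 x : nat -> V, permitted x &
    forall j, rmf_label rho dist U theta (x j) w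
            < rmf_label rho dist U theta (x j.+1) w].

(* All values of theta are coupled through the same family [U]; the
   probabilities involved depend only on the joint law of [U]. *)
Definition rmf_theta_c (R : realType) (dsp : measure_display)
    (Omega : measurableType dsp) (P : probability Omega R)
    (V : choiceType) (rho : V) (dist : V -> V -> R)
    (permitted : set (nat -> V)) (U : V -> {RV P >-> R}) : R :=
  inf [set theta : R | 0 <= theta <= 1 /\
    (0 < P (rmf_percolation rho dist permitted U theta))%E].

Definition l1norm (n : nat) (x : 'rV[int]_n) : int := \sum_(i < n) `|x 0 i|.

Definition Zn_adj (n : nat) : rel 'rV[int]_n := fun x y => l1norm (x - y) == 1.

(* Only used for 1 <= q; the last branch is q = +oo. *)
Definition lq_norm (R : realType) (n : nat) (q : \bar R) (x : 'rV[int]_n) : R :=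
  match q with
  | r%:E => (\sum_(i < n) `|(x 0 i)%:~R : R| `^ r) `^ r^-1
  | _ => \big[Num.max/0]_(i < n) `|(x 0 i)%:~R : R|
  end.

Definition lq_dist (R : realType) (n : nat) (q : \bar R) (x y : 'rV[int]_n) : R :=
  lq_norm q (x - y).

Definition all_rays (n : nat) : set (nat -> 'rV[int]_n) :=
  simple_ray (@Zn_adj n) 0.

Definition non_backtracking_rays (n : nat) : set (nat -> 'rV[int]_n) :=
  [set x | simple_ray (@Zn_adj n) 0 x /\
           forall j, l1norm (x j) < l1norm (x j.+1)].

(* Main.v *)
Require Import Defs.
From HB Require Import structures.
From mathcomp Require Import all_boot all_order all_algebra finmap.
From mathcomp Require Import ring lra zify.
From mathcomp Require Import all_classical all_reals all_analysis.

Set Implicit Arguments.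
Unset Strict Implicit.
Unset Printing Implicit Defensive.

Import Order.TTheory GRing.Theory Num.Theory.
Import numFieldNormedType.Exports.

Local Open Scope classical_set_scope.
Local Open Scope ring_scope.

(** Along a permitted ray the distance to the root grows by at most 1 per step,
    so an increasing ray satisfies the slack inequalities
    [U (x j) < U (x j.+1) + theta] for all [j].  The proof is a first moment
    bound on the number of finite paths satisfying these inequalities.

    For a fixed path on [K] distinct vertices the slack event has the volume of
    the set of points of the unit cube with [u_j < u_(j+1) + theta].  After the
    shift [y_j = u_j + j theta] the coordinates increase inside an interval of
    length at most [1 + K theta], so this volume is at most
    [(1 + K theta)^K / K!].  Cutting [0, 1[ into [K] cells turns this integral
    into a count of strictly increasing integer sequences, which needs nothing
    beyond the product rule for finitely many labels, at the price of replacing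
    [1 + K theta] by [3 + K theta] ([prob_slack_path]).

    If there are at most [C D^k] permitted paths with [k] edges and
    [theta <= 1 / (D e)], then with [K = k + 1] the expected number of slack
    paths is of order [K^K / (K! e^K)], that is of order [1 / sqrt K].  Hence it
    tends to 0 even at the threshold itself; the weaker bound
    [K! e^K >= (K + 1)^(1/4) K^K] suffices for that
    ([weak_stirling], [expected_paths_small], [ae_no_percolation]).

    It remains to count paths.  In a graph of maximum degree [Delta] a simple
    path never steps back to the vertex it comes from, which gives
    [D = Delta - 1] ([simple_ray_prefixes]).  On the lattice of dimension [n], a
    path moving away from the origin in l1 norm never leaves the closed orthants
    that contain its endpoint; once one of the [2^n] orthants is chosen there
    are [n] choices per step, which gives [D = n] ([outward_ray_prefixes]).

    The bounds on the critical value need two more facts.  The percolation event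
    is measurable, because by Koenig's lemma it is a countable intersection of
    events on finitely many labels ([measurable_rmf_percolation]); so it has
    probability 0, and not merely a null cover, below the threshold.  And the set
    whose infimum defines the critical value contains 1, because at
    [theta = 1] the labels increase along a coordinate axis almost surely
    ([percolation_theta1]). *)

(** * A weak form of Stirling's formula *)

Lemma bernoulli_ineq (R : realDomainType) (x : R) n :
  0 <= x -> 1 + n%:R * x <= (1 + x) ^+ n.
Proof.
move=> x0; elim: n => [|n IHn]; first by rewrite mul0r addr0 expr0.
have nx0 : 0 <= n%:R * x * x by rewrite !mulr_ge0.
have := ler_wpM2r (_ : 0 <= 1 + x) IHn; rewrite -exprSr addr_ge0// => /(_ isT).
by apply: le_trans; rewrite -natr1; nra.
Qed.

(** One step of the induction for [weak_stirling]: it bounds from below by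
    [1 + 1 / (4 (n + 1))] the growth factor of [n! e^n / n^n], which is
    [e n^n / (n + 1)^n].  Second order information on the exponential is needed,
    and [expR x >= (1 + x / 2) ^ 2] at [x = 1 / n] is enough of it. *)
Lemma expr1_growth (R : realType) n :
  n.+1%:R ^+ n * (1 + (4 * n.+1%:R)^-1) <= expR 1 * n%:R ^+ n :> R.
Proof.
case: n => [|n].
  rewrite !expr0 mul1r !mulr1; have := expR_ge1Dx (1 : R); lra.
set K : R := n.+1%:R; have K0 : 0 < K by rewrite /K ltr0n.
have KS : n.+2%:R = K + 1 by rewrite /K natr1.
rewrite KS -[expR 1](_ : expR (K^-1) ^+ n.+1 = _); last first.
  by rewrite -expRM_natl -/K mulfV ?gt_eqF.
rewrite -exprMn.
have half : 1 + K^-1 / 2 <= expR (K^-1 / 2) by exact: expR_ge1Dx.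
(* (1 + 1/(2K))^2 factors as (1 + 1/K) (1 + 1/(4K(K+1))). *)
have sq : (1 + K^-1) * (1 + (4 * K * (K + 1))^-1) <= expR (K^-1).
  have -> : K^-1 = K^-1 / 2 + K^-1 / 2 by field; rewrite gt_eqF.
  have half0 : 0 <= 1 + K^-1 / 2 by rewrite addr_ge0// divr_ge0// invr_ge0 ltW.
  rewrite expRD; have := ler_pM half0 half0 half half; apply: le_trans.
  rewrite le_eqVlt; apply/orP; left; apply/eqP; field.
  by rewrite !gt_eqF// addr_gt0.
have e0 : 0 <= (4 * K * (K + 1))^-1 by rewrite invr_ge0 !mulr_ge0 ?addr_ge0 ?ltW.
have := bernoulli_ineq n.+1 e0.
rewrite -/K (_ : K * (4 * K * (K + 1))^-1 = (4 * (K + 1))^-1); last first.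
  by field; rewrite !gt_eqF// addr_gt0.
move=> /(ler_wpM2l (_ : 0 <= (K + 1) ^+ n.+1)) bern.
apply: le_trans (bern _) _; first by rewrite exprn_ge0// addr_ge0// ltW.
rewrite -exprMn lerXn2r ?nnegrE//.
- by rewrite mulr_ge0 ?addr_ge0// ltW.
- by rewrite mulr_ge0 ?expR_ge0// ltW.
have := ler_wpM2r (ltW K0) sq; apply: le_trans.
rewrite le_eqVlt; apply/orP; left; apply/eqP; field.
by rewrite ?gt_eqF// ?addr_gt0.
Qed.

(** The true order of [n! e^n / n^n] is [sqrt n].  The fourth power comes from
    [(1 + 1 / (4 K)) ^ 4 >= 1 + 1 / K = (K + 1) / K], which telescopes. *)
Lemma weak_stirling (R : realType) n :
  n.+1%:R * (n%:R ^+ n) ^+ 4 <= (n`!%:R * expR 1 ^+ n) ^+ 4 :> R.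
Proof.
elim: n => [|n IHn]; first by rewrite fact0 !expr0 !mulr1 !expr1n.
set e : R := expR 1 in IHn *; set b := n`!%:R * e ^+ n in IHn.
have -> : n.+1`!%:R * e ^+ n.+1 = n.+1%:R * (e * b) :> R.
  by rewrite factS natrM (exprS e) /b; ring.
set K : R := n.+1%:R in IHn *; have K0 : 0 < K by rewrite /K ltr0n.
have -> : n.+2%:R = K + 1 :> R by rewrite /K natr1.
have d0 : 0 <= (4 * K)^-1 by rewrite invr_ge0 mulr_ge0// ltW.
have grow := expr1_growth R n; rewrite -/K -/e in grow.
have -> : (K + 1) * (K ^+ n.+1) ^+ 4 = K ^+ 4 * ((K + 1) * (K ^+ n) ^+ 4).
  by rewrite (exprS K n) exprMn mulrCA.
rewrite [leRHS]exprMn ler_wpM2l//; first by rewrite exprn_ge0// ltW.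
apply: (@le_trans _ _ (K * (e * n%:R ^+ n) ^+ 4)); last first.
  by rewrite exprMn mulrCA [leRHS]exprMn ler_wpM2l// exprn_ge0// expR_ge0.
apply: (@le_trans _ _ (K * (K ^+ n * (1 + (4 * K)^-1)) ^+ 4)); last first.
  rewrite ler_wpM2l// lerXn2r ?nnegrE//.
    by rewrite mulr_ge0 ?exprn_ge0 ?addr_ge0.
  by rewrite mulr_ge0 ?expR_ge0// exprn_ge0.
rewrite [leLHS]mulrC [leRHS](_ : _ = (K ^+ n) ^+ 4 * (K * (1 + (4 * K)^-1) ^+ 4)).
  rewrite ler_wpM2l ?exprn_ge0//; move: (ler_wpM2l (ltW K0) (bernoulli_ineq 4 d0)).
  apply: le_trans; rewrite le_eqVlt; apply/orP; left; apply/eqP; field.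
  by rewrite gt_eqF.
by rewrite exprMn mulrCA.
Qed.

Lemma stirling_ratio_small (R : realType) (eps : R) : 0 < eps ->
  exists2 n, (0 < n)%N & n%:R ^+ n <= eps * (n`!%:R * expR 1 ^+ n).
Proof.
move=> eps0; pose n := (Num.truncn (eps ^+ 4)^-1).+1.
exists n => //; have e40 : 0 < eps ^+ 4 by rewrite exprn_gt0.
have en : 1 <= eps ^+ 4 * n.+1%:R.
  rewrite -ler_pdivrMl// mulr1 ltW//.
  by apply: (lt_trans (truncnS_gt _)); rewrite ltr_nat.
have nn0 : 0 <= n%:R ^+ n :> R by rewrite exprn_ge0.
have b0 : 0 <= eps * (n`!%:R * expR 1 ^+ n).
  by rewrite !mulr_ge0 ?exprn_ge0 ?expR_ge0 ?ltW.
rewrite -(@ler_pXn2r _ 4)//.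
rewrite (exprMn _ eps); have := ler_wpM2l (ltW e40) (weak_stirling R n).
apply: le_trans; rewrite mulrA ler_peMl// exprn_ge0//.
Qed.

(** Adding [j * m.+1] to the entry of index [j] makes such a sequence strictly
    increasing; this is the discrete form of the shift [y_j = u_j + j theta]. *)
Lemma card_almost_increasing K N m :
  (#|[set c : K.-tuple 'I_N | sorted (fun a b => a <= b + m) (map val c)]|
    <= 'C(N + K * m.+1, K))%N.
Proof.
rewrite -card_ltn_sorted_tuples.
have lt_shift (c : K.-tuple 'I_N) (j : 'I_K) :
    (tnth c j + j * m.+1 < N + K * m.+1)%N.
  by rewrite -addSn leq_add// leq_mul2r ltnW ?orbT.
pose shift c := mktuple (fun j => Ordinal (lt_shift c j)).
have shift_inj : injective shift.
  move=> c d cd; apply: eq_from_tnth => j; apply/val_inj/eqP.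
  have /(congr1 (fun t => val (tnth t j))) := cd.
  by rewrite !tnth_mktuple /= => /addIn ->.
have nth_val M (t : K.-tuple 'I_M) i (iK : (i < K)%N) :
    nth 0%N (map val t) i = tnth t (Ordinal iK).
  by rewrite -(tnth_nth _ [tuple of map val t] (Ordinal iK)) tnth_map.
rewrite -(card_imset _ shift_inj) subset_leq_card//.
apply/fintype.subsetP => _ /imsetP[c /[!inE] /(sortedP 0%N) csort ->].
apply/(sortedP 0%N) => i; rewrite size_map size_tuple => iK.
have := csort i; rewrite size_map size_tuple => /(_ iK).
rewrite !(nth_val _ _ _ (ltnW iK)) !(nth_val _ _ _ iK) !tnth_mktuple /=; lia.
Qed.

Lemma ffact_le_expn n k : (n ^_ k <= n ^ k)%N.
Proof.
rewrite ffact_prod -[k in (_ ^ k)%N]card_ord -prod_nat_const.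
by apply: leq_prod => i _; exact: leq_subr.
Qed.

(** * The probability that a path satisfies the slack inequalities *)

Section uniform_labels.
Context (R : realType) (dsp : measure_display) (Omega : measurableType dsp).
Variable P : probability Omega R.

Lemma uniform01_itvco (X : {RV P >-> R}) (a b : R) :
  uniform01 X -> 0 <= a -> a <= b -> b <= 1 ->
  P (X @^-1` `[a, b[) = (b - a)%:E.
Proof.
move=> unifX a0 ab b1; have := unifX `[a, b[%classic (measurable_itv _).
rewrite {1}/distribution /pushforward => ->.
rewrite /uniform_prob integral_uniform_pdf setIidl; last first.
  move=> x /=; rewrite !in_itv/= => /andP[ax xb].
  by rewrite (le_trans a0 ax) (le_trans (ltW xb) b1).
rewrite (eq_integral (cst 1%E)).
  rewrite integral_cst//=. rewrite mul1e lebesgue_measure_itv/= lte_fin EFinB.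
  by case: ltgtP ab => // -> _; rewrite subee.
move=> x; rewrite inE/= in_itv/= => /andP[ax xb].
rewrite /uniform_pdf (le_trans a0 ax) (le_trans (ltW xb) b1)/=.
by rewrite subr0 invr1.
Qed.

Lemma uniform01_outside (X : {RV P >-> R}) :
  uniform01 X -> P (X @^-1` (~` `[0, 1[)) = 0%E.
Proof.
move=> unifX; rewrite preimage_setC probability_setC.
  by rewrite (uniform01_itvco unifX)// subr0 subee.
exact: (measurable_funPTI X (measurable_itv `[0, 1[)).
Qed.

Lemma measurable_outside (X : {RV P >-> R}) :
  measurable (X @^-1` (~` `[0, 1[)).
Proof.
rewrite preimage_setC; apply: measurableC.
exact: (measurable_funPTI X (measurable_itv `[0, 1[)).
Qed.

Lemma measurable_slack_lt (X Y : {RV P >-> R}) (a b : R) :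
  measurable [set w | X w + a < Y w + b].
Proof.
have lt_fun : measurable_fun setT (fun w => X w + a < Y w + b).
  apply: measurable_realfun.measurable_fun_ltr;
  by apply: measurable_realfun.measurable_funD => //; exact: measurable_cst.
have := lt_fun measurableT [set true] ltac:(by []).
by rewrite setTI; congr measurable; apply/seteqP; split => w /=; case: (_ < _).
Qed.

Lemma measurable_sorted (V : choiceType) (r : Omega -> rel V) (p : seq V) :
  (forall u v, measurable [set w | r w u v]) ->
  measurable [set w | sorted (r w) p].
Proof.
move=> mr; have mtrue : measurable [set _ : Omega | true].
  by rewrite (_ : mkset _ = setT)//; apply/seteqP; split.
case: p => [//|v p] /=; elim: p v => [//|u p IHp] v /=.
have -> : [set w | r w v u && path (r w) u p] =
    [set w | r w v u] `&` [set w | path (r w) u p].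
  by apply/seteqP; split => w /= /andP.
exact: measurableI.
Qed.

(** Lets the deterministic part of a condition on a path be set aside. *)
Lemma measurable_andb (b : bool) (Q : Omega -> bool) :
  measurable [set w | Q w] -> measurable [set w | b && Q w].
Proof.
case: b => //= _; have -> : [set w : Omega | false] = set0 by apply/seteqP; split.
exact: measurable0.
Qed.

Lemma exists_mem_cons (I : eqType) (i : I) (s : seq I) (F : I -> set Omega) :
  [set w | exists2 j, j \in i :: s & F j w] =
  F i `|` [set w | exists2 j, j \in s & F j w].
Proof.
apply/seteqP; split=> w /=.
  by move=> [j /[!inE] /predU1P[-> | js] Fw]; [left | right; exists j].
by move=> [Fw | [j js Fw]]; [exists i | exists j]; rewrite ?inE ?eqxx ?js ?orbT.
Qed.

Lemma measurable_exists_mem (I : eqType) (s : seq I) (F : I -> set Omega) :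
  (forall i, measurable (F i)) -> measurable [set w | exists2 i, i \in s & F i w].
Proof.
move=> mF; elim: s => [|i s IHs].
  by rewrite (_ : mkset _ = set0)//; apply/seteqP; split=> // w [].
by rewrite exists_mem_cons; exact: measurableU.
Qed.

Lemma union_bound (I : eqType) (s : seq I) (F : I -> set Omega) (b : R) :
  (forall i, measurable (F i)) -> (forall i, i \in s -> (P (F i) <= b%:E)%E) ->
  (P [set w | exists2 i, i \in s & F i w] <= ((size s)%:R * b)%:E)%E.
Proof.
move=> mF; elim: s => [|i s IHs] Pb.
  rewrite (_ : mkset _ = set0) ?measure0 ?mul0r//.
  by apply/seteqP; split=> // w [].
rewrite exists_mem_cons.
apply: le_trans (measureU2 _ (mF i) (measurable_exists_mem s mF)) _.
rewrite (_ : (size (i :: s))%:R * b = b + (size s)%:R * b); last first.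
  by rewrite /= -natr1 mulrDl mul1r addrC.
rewrite EFinD; apply: leeD; first by apply: Pb; rewrite mem_head.
by apply: IHs => j js; apply: Pb; rewrite inE js orbT.
Qed.

Variables (V : choiceType) (U : V -> {RV P >-> R}).

Lemma measurable_slack_path (p : seq V) (theta : R) :
  measurable [set w | sorted (fun u v => U u w < U v w + theta) p].
Proof.
apply: measurable_sorted => u v.
rewrite (_ : mkset _ = [set w | U u w + 0 < U v w + theta]).
  exact: measurable_slack_lt.
by apply/seteqP; split=> w /=; rewrite addr0.
Qed.

Hypothesis iidU : iid_uniform01 U.

Lemma prob_cells (p : seq V) (K : nat) (c : seq nat) :
  uniq p -> (0 < K)%N -> all (ltn^~ K) c -> size c = size p ->
  P [set w | forall v, v \in p ->
      U v w \in `[(nth 0%N c (index v p))%:R / K%:R,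
                  (nth 0%N c (index v p)).+1%:R / K%:R[%R]
  = ((K%:R ^+ size p)^-1)%:E.
Proof.
move=> up K0 cK szc; pose J v : set R :=
  `[(nth 0%N c (index v p))%:R / K%:R, (nth 0%N c (index v p)).+1%:R / K%:R[%classic.
have := iidU.1 [fset v in p]%fset J (fun v => measurable_itv _).
rewrite (_ : \bigcap_(i in _) _ =
    [set w | forall v, v \in p -> J v (U v w)]); last first.
  apply/seteqP; split=> w /= h v vp; apply: h; move: vp => /=.
    by rewrite in_fset.
  by rewrite in_fset.
move=> ->.
have KR0 : (0 : R) < K%:R by rewrite ltr0n.
rewrite big_seq (eq_bigr (fun=> (K%:R^-1 : R)%:E)).
  rewrite -big_seq prodEFin big_const_seq count_predT iter_mulr_1.
  by rewrite -exprVn card_fseq (undup_id up).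
move=> v; rewrite !inE/= => vp.
have cv : (nth 0%N c (index v p) < K)%N.
  by apply: (allP cK); rewrite mem_nth// szc index_mem.
rewrite (uniform01_itvco (iidU.2 v))//.
- by rewrite -mulrBl -natrB// subSnn mul1r.
- by rewrite ler_wpM2r ?invr_ge0// ler_nat.
- by rewrite ler_pdivrMr// mul1r ler_nat.
Qed.


Lemma measurable_cells (p : seq V) (c : V -> interval R) :
  measurable [set w | forall v, v \in p -> U v w \in c v].
Proof.
rewrite (_ : mkset _ = ~` [set w | exists2 v, v \in p & U v w \notin c v]).
  apply/measurableC/measurable_exists_mem => v.
  apply: (measurable_funPTI (U v) (Y := [set x | x \notin c v])).
  rewrite (_ : mkset _ = ~` [set` c v]); first exact: measurableC.
  by apply/seteqP; split=> x /= /negP.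
apply/seteqP; split=> w /=.
  by move=> h [v /h ->].
by move=> h v vp; apply/negPn/negP => nc; apply: h; exists v.
Qed.

(** The slack [m + 1], where [m] is the integer part of [K theta], rather than
    [m], absorbs the rounding of the labels to multiples of [1 / K].  Then
    [card_almost_increasing] counts increasing sequences in an interval of
    length [K (m + 3)]. *)
Lemma card_almost_increasing_le (K : nat) (theta : R) : (0 < K)%N -> 0 <= theta ->
  #|[set c : K.-tuple 'I_K |
      sorted (fun a b => a <= b + (Num.truncn (K%:R * theta)).+1)%N (map val c)]|%:R
    * (K%:R ^+ K)^-1 <= (K%:R * theta + 3) ^+ K / K`!%:R :> R.
Proof.
move=> K0 theta0; set m := Num.truncn _.
have mle : m%:R <= K%:R * theta by rewrite truncn_le mulr_ge0.
have KK0 : 0 < K%:R ^+ K :> R by rewrite exprn_gt0// ltr0n.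
rewrite ler_pdivrMr// mulrAC ler_pdivlMr ?ltr0n ?fact_gt0// -exprMn.
have /(leq_mul (leqnn K`!)) := card_almost_increasing K K m.+1.
rewrite [leqRHS]mulnC bin_ffact => card_le.
apply: (@le_trans _ _ (((m + 3) * K) ^ K)%:R).
  rewrite -natrM ler_nat mulnC; apply: (leq_trans card_le).
  rewrite (_ : K + K * m.+2 = (m + 3) * K)%N; last by lia.
  exact: ffact_le_expn.
rewrite natrX lerXn2r ?nnegrE ?mulr_ge0 ?addr_ge0 ?mulr_ge0//.
by rewrite natrM ler_wpM2r// natrD lerD2r.
Qed.

(** The label of each vertex is rounded down to a multiple of [1 / K].  The
    slack inequalities survive the rounding up to one unit, and by independence
    each of the [K ^ K] vectors of rounded labels has probability [K ^ - K].
    The mesh [1 / K] is already fine enough: refining it would only improve the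
    constant 3, which costs a bounded factor in the first moment. *)
Lemma prob_slack_path (p : seq V) (theta : R) :
  uniq p -> (0 < size p)%N -> 0 <= theta ->
  (P [set w | sorted (fun u v => U u w < U v w + theta)%R p]
    <= (((size p)%:R * theta + 3) ^+ size p / (size p)`!%:R)%:E)%E.
Proof.
case: p => [//|v0 p'] up _ theta0; set p := v0 :: p' in up *.
set K := size p; have KR0 : 0 < K%:R :> R by rewrite ltr0n.
set m := Num.truncn (K%:R * theta).
pose good := enum [set c : K.-tuple 'I_K |
  sorted (fun a b => a <= b + m.+1)%N (map val c)].
pose cell (c : K.-tuple 'I_K) := [set w | forall v, v \in p -> U v w \in
  `[(nth 0%N (map val c) (index v p))%:R / K%:R,
    (nth 0%N (map val c) (index v p)).+1%:R / K%:R[%R].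
(* Null event on which some label of the path falls in no cell. *)
pose out := [set w | exists2 v, v \in p & (U v @^-1` (~` `[0, 1[)) w].
have mout v := measurable_outside (U v).
have mcell c : measurable (cell c) by exact: measurable_cells.
have cover : [set w | sorted (fun u v => U u w < U v w + theta) p] `<=`
    out `|` [set w | exists2 c, c \in good & cell c w].
  move=> w slack.
  have [in01|/allPn[v vp vout]] := boolP (all (fun v => 0 <= U v w < 1) p); last first.
    by left; exists v => //=; rewrite in_itv/=; exact/negP.
  right; pose k v := Num.truncn (K%:R * U v w).
  have kP v : 0 <= U v w < 1 -> (k v)%:R <= K%:R * U v w < (k v).+1%:R.
    by move=> /andP[Uv0 _]; apply: truncn_itv; rewrite mulr_ge0.
  have kK v : 0 <= U v w < 1 -> (k v < K)%N.
    move=> Uv; have /andP[kU _] := kP v Uv; have /andP[_ U1] := Uv.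
    by rewrite -(ltr_nat R); apply: (le_lt_trans kU); rewrite gtr_pMr.
  pose c : K.-tuple 'I_K := 
    map_tuple (fun v => inord (k v) : 'I_(size p').+1) (in_tuple p).
  have valc : map val c = map k p.
    rewrite -[LHS](map_comp _ _ p); apply/eq_in_map => v vp /=.
    by rewrite inordK//; exact: kK (allP in01 v vp).
  exists c; last first.
    move=> v vp; rewrite valc (nth_map v0) ?index_mem// nth_index// in_itv/=.
    have /andP[k1 k2] := kP v (allP in01 v vp).
    by rewrite ler_pdivrMr// ltr_pdivlMr// ![_ * K%:R]mulrC k1 k2.
  suff : sorted (fun a b => a <= b + m.+1)%N (map val c).
    by rewrite mem_enum inE.
  rewrite valc sorted_map.
  apply: sub_in_sorted in01 slack => u v /kP/andP[ku _] /kP/andP[_ kv] /= Uuv.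
  have mP := truncnS_gt (K%:R * theta); rewrite -/m in mP.
  rewrite -ltnS -addnS -addSnnS -(ltr_nat R) natrD.
  have : K%:R * U u w < K%:R * (U v w + theta) by rewrite ltr_pM2l.
  by move: ku kv mP; rewrite mulrDr; lra.
have mgood := measurable_exists_mem good mcell.
have mout' := measurable_exists_mem p mout.
apply: le_trans (le_measure _ _ _ cover) _; rewrite ?inE.
- exact: measurable_slack_path.
- exact: measurableU.
apply: le_trans (measureU2 _ mout' mgood) _.
rewrite -[leRHS]add0e; apply: leeD.
  have Pout v : v \in p -> (P (U v @^-1` (~` `[0%R, 1%R[)) <= 0%:E)%E.
    by move=> _; rewrite uniform01_outside//; exact: iidU.2.
  by have := union_bound mout Pout; rewrite mulr0.
have goodP c : c \in good -> (P (cell c) <= ((K%:R ^+ K)^-1)%:E)%E.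
  move=> _; rewrite prob_cells ?size_map ?size_tuple//.
  by apply/allP => _ /mapP[i _ ->]; exact: ltn_ord.
apply: le_trans (union_bound mcell goodP) _.
by rewrite lee_fin /good -cardE; exact: card_almost_increasing_le.
Qed.

End uniform_labels.

(** * Vanishing of the first moment *)

(** Since [D theta <= 1 / e], the [K]-th power of [D (K theta + 3)] is at most
    [(K / e) ^ K (1 + 3 D e / K) ^ K], whose last factor stays below
    [expR (3 D e)]. *)
Lemma expected_paths_small (R : realType) (C D theta eps : R) :
  0 < C -> 0 < D -> 0 <= theta -> theta <= 1 / (D * expR 1) -> 0 < eps ->
  exists k, C * D ^+ k * ((k.+1%:R * theta + 3) ^+ k.+1 / k.+1`!%:R) <= eps.
Proof.
move=> C0 D0 theta0 thetaD eps0; set e := expR 1 in thetaD.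
have e0 : 0 < e by exact: expR_gt0.
pose M := expR (3 * D * e); have M0 : 0 < M by exact: expR_gt0.
have [[//|k] _ small] := stirling_ratio_small
  (divr_gt0 (mulr_gt0 eps0 D0) (mulr_gt0 C0 M0)).
exists k; set K : R := k.+1%:R in small *; have K0 : 0 < K by rewrite ltr0n.
have Dtheta : D * (K * theta + 3) <= K / e * expR (3 * D * e / K).
  apply: (@le_trans _ _ (K / e * (1 + 3 * D * e / K))); last first.
    by rewrite ler_wpM2l ?expR_ge1Dx// divr_ge0// ltW.
  rewrite (_ : K / e * _ = K / e + 3 * D); last by field; rewrite !gt_eqF.
  rewrite mulrDr [D * 3]mulrC lerD2r mulrCA ler_wpM2l//.
  by move: thetaD; rewrite div1r invfM ler_pdivlMl.
have DX0 : 0 <= D * (K * theta + 3).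
  by apply: mulr_ge0; [exact: ltW | rewrite addr_ge0// mulr_ge0// ltW].
have := lerXn2r k.+1 _ _ Dtheta; rewrite !nnegrE => /(_ DX0 (le_trans DX0 Dtheta)).
rewrite exprMn [leRHS]exprMn -[X in _ <= _ * X]expRM_natl -/K.
rewrite [X in expR X]mulrC divfK ?gt_eqF// -/M expr_div_n => pow_le.
have f0 : 0 < k.+1`!%:R :> R by rewrite ltr0n fact_gt0.
rewrite mulrA ler_pdivrMr//.
have ek0 : 0 < e ^+ k.+1 by rewrite exprn_gt0.
rewrite -(ler_pM2l D0) [leLHS](_ : _ = C * (D ^+ k.+1 * (K * theta + 3) ^+ k.+1)).
  apply: le_trans (ler_wpM2l (ltW C0) pow_le) _.
  rewrite [leLHS](_ : _ = K ^+ k.+1 * (C * M / e ^+ k.+1)); last first.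
    by move: (K ^+ _) (_ ^-1) => x y; ring.
  have CMe0 : 0 <= C * M / e ^+ k.+1 by rewrite divr_ge0 ?mulr_ge0 ?ltW.
  apply: le_trans (ler_wpM2r CMe0 small) _; rewrite -/e.
  rewrite le_eqVlt; apply/orP; left; apply/eqP; field.
  by rewrite !gt_eqF.
by rewrite (exprS D); move: (D ^+ k) (_ ^+ k.+1) => x y; ring.
Qed.

(** * Infinite rays and their finite prefixes *)

Lemma sorted_mkseqP (T : eqType) (r : rel T) (x : nat -> T) :
  (forall k, sorted r (mkseq x k)) <-> (forall j, r (x j) (x j.+1)).
Proof.
split=> [srt j|rx k].
  have /(sortedP (x 0%N))/(_ j) := srt j.+2.
  by rewrite size_mkseq !nth_mkseq//; apply.
apply/(sortedP (x 0%N)) => j; rewrite size_mkseq => jk.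
by rewrite !nth_mkseq// ltnW.
Qed.

Lemma uniq_mkseqP (T : eqType) (x : nat -> T) :
  (forall k, uniq (mkseq x k)) <-> injective x.
Proof.
split=> [ux i j xij|injx k]; last by rewrite map_inj_uniq// iota_uniq.
have /mkseq_uniqP inj := ux (maxn i j).+1.
by apply: (inj i j _ _ xij); rewrite inE ltnS ?leq_maxl ?leq_maxr.
Qed.

(** Koenig's lemma for a prefix-closed set of finite sequences that is finitely
    branching: the list [next p] contains all the one-letter extensions of [p].
    A sequence with extensions of every length inside [A] has a one-letter
    extension with the same property, for otherwise the finitely many bounds on
    the extensions of its successors would bound its own. *)
Lemma koenig (T : eqType) (A : seq T -> Prop) (next : seq T -> seq T) :
  (forall p v, A (rcons p v) -> A p /\ v \in next p) ->
  (forall k, exists2 p, size p = k & A p) ->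
  exists x : nat -> T, forall k, A (mkseq x k).
Proof.
move=> Aext Ainf.
have Aprefix p s : A (p ++ s) -> A p.
  by elim/last_ind: s => [|s v IHs]; rewrite ?cats0// -rcons_cat => /Aext[/IHs].
pose alive p := forall k, exists2 s, size s = k & A (p ++ s).
have extend (p : {p | alive p}) : exists v, alive (rcons (sval p) v).
  case: p => p alp /=; apply: contrapT => dead.
  have /choice[f fP] : forall v, exists k, forall s,
      size s = k -> ~ A (rcons p v ++ s).
    move=> v; apply: contrapT => nk; apply: dead; exists v => k.
    apply: contrapT => nks; apply: nk; exists k => s sk As.
    by apply: nks; exists s.
  have [[//|v s] [sizes] As] := alp (\max_(v <- next p) f v).+1.
  rewrite -cat_rcons in As.
  have fv : (f v <= size s)%N.
    rewrite sizes; apply: leq_bigmax_seq => //.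
    by have [] := Aext _ _ (Aprefix _ _ As).
  apply: (fP v (take (f v) s)); first by rewrite size_takel.
  by apply: (Aprefix _ (drop (f v) s)); rewrite -catA cat_take_drop.
have [g gP] := choice extend.
pose grow (p : {p | alive p}) : {p | alive p} := exist alive _ (gP p).
pose p0 : {p | alive p} := exist alive [::] Ainf.
pose x n := g (iter n grow p0).
have xE n : mkseq x n = sval (iter n grow p0).
  by elim: n => [//|n IHn]; rewrite mkseqS IHn.
exists x => k; rewrite xE; case: (iter k grow p0) => p alp /=.
by have [s /size0nil -> ] := alp 0%N; rewrite cats0.
Qed.

(** * Measurability and almost sure absence of percolation *)

Section percolation.
Context (R : realType) (dsp : measure_display) (Omega : measurableType dsp).
Context (P : probability Omega R) (V : choiceType) (U : V -> {RV P >-> R}).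
Variables (rho : V) (dist : V -> V -> R).

Lemma measurable_label_lt (theta : R) u v :
  measurable [set w | rmf_label rho dist U theta u w < rmf_label rho dist U theta v w].
Proof. exact: measurable_slack_lt. Qed.

(** The event involves uncountably many rays.  By Koenig's lemma it coincides
    with the existence, for every [k], of an increasing simple path on [k]
    vertices from the root, and local finiteness leaves finitely many of those. *)
Lemma measurable_rmf_percolation (e : rel V) (nbr : V -> seq V) (theta : R) :
  (forall u v, e u v -> v \in nbr u) ->
  measurable (rmf_percolation rho dist (simple_ray e rho) U theta).
Proof.
move=> nbrP; set X := rmf_label rho dist U theta.
pose A w p := [&& uniq p, head rho p == rho, sorted e p &
  sorted (fun u v => X u w < X v w) p].
(* Heading the list with rho also accounts for the first vertex, which extends
   the empty path; the spurious extensions by rho are discarded by A. *)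
pose next p := rho :: nbr (last rho p).
pose level k := iter k
  (fun L => [seq rcons p v | p <- L, v <- next p]) [:: [::]].
have Aext w p v : A w (rcons p v) -> A w p /\ v \in next p.
  case: p => [|u p] /and4P[].
    by move=> _ /eqP/= -> _ _; rewrite /A /next /= inE !eqxx.
  rewrite /A /next /= !rcons_path rcons_uniq mem_rcons /= inE negb_or.
  move=> /andP[/andP[_ up] /andP[_ uu]] ur /andP[pe ev] /andP[pX _].
  by rewrite up uu ur pe pX inE (nbrP _ _ ev) orbT.
have A_level w p : A w p -> p \in level (size p).
  elim/last_ind: p => [//|p v IHp] /Aext[/IHp Lp vp].
  by rewrite size_rcons /level iterS -/(level _); apply/allpairsPdep; exists p, v.
rewrite (_ : rmf_percolation _ _ _ _ _ = \bigcap_k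
    [set w | exists2 p, p \in level k & (size p == k) && A w p]).
  apply: bigcap_measurable => // k _; apply: measurable_exists_mem => p.
  do 4!apply: measurable_andb.
  by apply: measurable_sorted => u v; exact: measurable_label_lt.
apply/seteqP; split=> w /=.
  move=> [x [x0 xe xinj] xX] k _ /=; have Ax : A w (mkseq x k).
    apply/and4P; split.
    - exact: (uniq_mkseqP x).2.
    - by case: k => //= k; rewrite x0.
    - exact: (sorted_mkseqP e x).2.
    - exact: (sorted_mkseqP (fun u v => X u w < X v w) x).2.
  by exists (mkseq x k); rewrite ?size_mkseq ?eqxx//; have := A_level _ _ Ax;
    rewrite size_mkseq.
move=> h; have [x xA] : exists x : nat -> V, forall k, A w (mkseq x k).
  apply: (koenig (Aext w)) => k.
  by have [p _ /andP[/eqP sp Ap]] := h k I; exists p.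
exists x; last first.
  by apply/(sorted_mkseqP (fun u v => X u w < X v w)) => k; have /and4P[] := xA k.
split.
- by have /and4P[_ /eqP] := xA 1%N.
- by apply/sorted_mkseqP => k; have /and4P[] := xA k.
- by apply/uniq_mkseqP => k; have /and4P[] := xA k.
Qed.

(** The first moment argument.  The paths to be counted enter through any lists
    [L] that contain the prefixes of the permitted rays; such lists may contain
    other sequences as well, which only matters for their size. *)
Lemma ae_no_percolation (S : set (nat -> V)) (C D theta : R) :
  iid_uniform01 U -> 0 < C -> 0 < D -> 0 <= theta ->
  theta <= 1 / (D * expR 1) ->
  (forall x, S x -> injective x) ->
  (forall x j, S x -> dist rho (x j.+1) <= dist rho (x j) + 1) ->
  (forall k, exists L : seq (seq V), (size L)%:R <= C * D ^+ k /\
     forall x, S x -> mkseq x k.+1 \in L) ->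
  {ae P, forall w, ~ rmf_percolation rho dist S U theta w}.
Proof.
move=> iidU C0 D0 theta0 thetaD Sinj Slip /choice[L LP].
pose slack p w := sorted (fun u v => U u w < U v w + theta) p.
pose A k := [set w | exists2 p,
  p \in [seq p <- L k | uniq p & size p == k.+1] & slack p w].
have mslack p : measurable [set w | slack p w] by exact: measurable_slack_path.
have mA k : measurable (A k) by exact: measurable_exists_mem.
have mcap : measurable (\bigcap_k A k) by exact: bigcap_measurable.
exists (\bigcap_k A k); split => //.
  apply/eqP; rewrite eq_le measure_ge0 andbT; apply/lee_addgt0Pr => eps eps0.
  rewrite add0e; have [k small] := expected_paths_small C0 D0 theta0 thetaD eps0.
  apply: (@le_trans _ _ (P (A k))).
    by apply: le_measure; rewrite ?inE//; exact: bigcap_inf.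
  have Pslack p : p \in [seq p <- L k | uniq p & size p == k.+1] ->
      (P [set w | slack p w] <=
        ((k.+1%:R * theta + 3) ^+ k.+1 / k.+1`!%:R)%:E)%E.
    rewrite mem_filter => /andP[/andP[up /eqP sp] _].
    by rewrite -sp; apply: prob_slack_path; rewrite ?sp.
  apply: le_trans (union_bound mslack Pslack) _; rewrite lee_fin.
  apply: le_trans small; rewrite ler_wpM2r ?divr_ge0 ?exprn_ge0 ?addr_ge0 ?mulr_ge0//.
  apply: le_trans (LP k).1; rewrite ler_nat size_filter; exact: count_size.
move=> w /= /contrapT[x Sx xX] k _; exists (mkseq x k.+1).
  by rewrite mem_filter (LP k).2// size_mkseq eqxx (uniq_mkseqP x).2//; exact: Sinj.
apply: (sorted_mkseqP (fun u v => U u w < U v w + theta) x).2 => j.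
have := xX j; rewrite /rmf_label => lt_label.
have := ler_wpM2l theta0 (Slip x j Sx); rewrite mulrDr mulr1; lra.
Qed.

End percolation.

(** * Counting prefixes of simple rays *)

Lemma extend_prefix_list (T : eqType) (S : set (nat -> T)) (k d : nat)
    (L : seq (seq T)) (next : seq T -> seq T) :
  (forall x, S x -> mkseq x k \in L) ->
  (forall x, S x -> x k \in next (mkseq x k) /\ (size (next (mkseq x k)) <= d)%N) ->
  exists L' : seq (seq T), (size L' <= size L * d)%N /\
    forall x, S x -> mkseq x k.+1 \in L'.
Proof.
move=> LS nextS; pose L0 := [seq p <- L | size (next p) <= d]%N.
exists [seq rcons p v | p <- L0, v <- next p]; split; last first.
  move=> x Sx; rewrite mkseqS; have [nx sx] := nextS x Sx.
  by apply/allpairsPdep; exists (mkseq x k), (x k); rewrite mem_filter sx LS.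
rewrite size_allpairs_dep; apply: (@leq_trans (size L0 * d)); last first.
  by rewrite leq_mul2r size_filter count_size orbT.
rewrite /L0; elim: L {LS L0} => //= p L IHL; case: ifP => //= pd.
by rewrite mulSn leq_add.
Qed.

(** The first step has at most [Delta] choices and each later one at most
    [Delta - 1], since the previous vertex is a neighbour that may not be
    revisited.  The factor 2 comes from [Delta <= 2 (Delta - 1)]. *)
Lemma simple_ray_prefixes (V : choiceType) (e : rel V) (rho : V)
    (nbr : V -> seq V) (Delta k : nat) :
  symmetric e -> (1 < Delta)%N ->
  (forall u v, e u v -> v \in nbr u) -> (forall u, size (nbr u) <= Delta)%N ->
  exists L : seq (seq V), (size L <= 2 * Delta.-1 ^ k)%N /\
    forall x, simple_ray e rho x -> mkseq x k.+1 \in L.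
Proof.
move=> esym Delta1 nbrP nbr_size; case: k => [|k].
  by exists [:: [:: rho]]; split=> // x [x0 _ _]; rewrite /mkseq/= x0 inE.
elim: k => [|k [L [sizeL LP]]].
  have [|x [x0 xe _]|L [sizeL LP]] := @extend_prefix_list _ (simple_ray e rho) 1
      Delta [:: [:: rho]] (fun p => nbr (last rho p)).
  - by move=> x [x0 _ _]; rewrite /mkseq/= x0 inE.
  - by split; [apply: nbrP; exact: xe | exact: nbr_size].
  exists L; split=> //; apply: leq_trans sizeL _ => /=; lia.
have [x [x0 xe xinj]|L' [sizeL' L'P]] :=
  @extend_prefix_list _ (simple_ray e rho) k.+2 Delta.-1 L
    (fun p => rem (nth rho p k) (nbr (last rho p))) LP; last first.
  exists L'; split=> //; apply: leq_trans sizeL' _.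
  by rewrite (expnSr _ k.+1) mulnA leq_mul2r sizeL orbT.
rewrite {2 4}mkseqS last_rcons nth_mkseq//.
have back : x k \in nbr (x k.+1) by apply: nbrP; rewrite esym.
split; last by rewrite size_rem// -!subn1 leq_sub2r.
have := nbrP _ _ (xe k.+1); rewrite (perm_mem (perm_to_rem back)) inE.
by case/predU1P => // /xinj; lia.
Qed.

Lemma ae_no_percolation_of_degree (R : realType) (dsp : measure_display)
    (Omega : measurableType dsp) (P : probability Omega R) (V : choiceType)
    (U : V -> {RV P >-> R}) (rho : V) (dist : V -> V -> R) (e : rel V)
    (nbr : V -> seq V) (Delta : nat) (theta : R) :
  iid_uniform01 U -> symmetric e -> (1 < Delta)%N ->
  (forall u v, e u v -> v \in nbr u) -> (forall u, size (nbr u) <= Delta)%N ->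
  (forall u v, e u v -> dist rho v <= dist rho u + 1) ->
  0 <= theta -> theta <= 1 / ((Delta%:R - 1) * expR 1) ->
  {ae P, forall w, ~ rmf_percolation rho dist (simple_ray e rho) U theta w}.
Proof.
move=> iidU esym Delta1 nbrP nbr_size edist theta0 thetac.
apply: (ae_no_percolation (C := 2) (D := Delta%:R - 1)) => //.
- by rewrite subr_gt0 ltr1n.
- by move=> x [].
- by move=> x j [_ xe _]; exact: edist.
move=> k; have [L [sizeL LP]] := simple_ray_prefixes rho k esym Delta1 nbrP nbr_size.
exists L; split=> //; rewrite -(ler_nat R) natrM natrX in sizeL.
by move: sizeL; rewrite -subn1 natrB// ltnW.
Qed.

Fixpoint walks (T : eqType) (next : T -> seq T) (v : T) (k : nat) : seq (seq T) :=
  if k is k'.+1 then [seq rcons p u | p <- walks next v k', u <- next (last v p)]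
  else [:: [:: v]].

Lemma size_walks (T : eqType) (next : T -> seq T) v d k :
  (forall u, size (next u) = d) -> size (walks next v k) = (d ^ k)%N.
Proof.
move=> sized; elim: k => //= k IHk; rewrite size_allpairs_dep.
rewrite (eq_map (fun p => sized (last v p))) expnSr -IHk.
by elim: (walks _ _ _) => //= p L ->; rewrite mulSn.
Qed.

Lemma mem_walks (T : eqType) (next : T -> seq T) (x : nat -> T) k :
  (forall j, (j < k)%N -> x j.+1 \in next (x j)) ->
  mkseq x k.+1 \in walks next (x 0%N) k.
Proof.
elim: k => [|k IHk] xnext; first by rewrite inE.
rewrite mkseqS; apply/allpairsPdep; exists (mkseq x k.+1), (x k.+1); split=> //.
  by apply: IHk => j jk; apply: xnext; rewrite ltnW.
by rewrite mkseqS last_rcons; exact: xnext.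
Qed.

(** * Lower bounds on the critical value *)

Section critical_value.
Context (R : realType) (dsp : measure_display) (Omega : measurableType dsp).
Context (P : probability Omega R) (V : choiceType) (U : V -> {RV P >-> R}).
Variables (rho : V) (dist : V -> V -> R) (e : rel V) (nbr : V -> seq V).
Hypotheses (iidU : iid_uniform01 U) (nbrP : forall u v, e u v -> v \in nbr u).

(** At [theta = 1] each step away from the root adds 1 to the drift, whereas two
    labels in [0, 1[ differ by less than 1. *)
Lemma percolation_theta1 (x : nat -> V) :
  simple_ray e rho x -> (forall j, dist rho (x j) = j%:R) ->
  (0 < P (rmf_percolation rho dist (simple_ray e rho) U 1))%E.
Proof.
move=> ex xdist.
have mout j := measurable_outside (U (x j)).
have mouts := bigcup_measurable (fun j (_ : setT j) => mout j).
have Pouts : P (\bigcup_j (U (x j) @^-1` (~` `[0%R, 1%R[))) = 0%E.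
  apply/(negligibleP _ mouts)/negligible_bigcup => j.
  by apply/(negligibleP _ (mout j))/uniform01_outside; exact: iidU.2.
have Pin : P (~` \bigcup_j (U (x j) @^-1` (~` `[0%R, 1%R[))) = 1%E.
  by rewrite probability_setC// [X in (_ - X)%E]Pouts sube0.
apply: (@lt_le_trans _ _ 1%E) => //; rewrite -Pin; apply: le_measure; rewrite ?inE.
- exact: measurableC.
- exact: measurable_rmf_percolation nbrP.
move=> w win; exists x => // j; rewrite /rmf_label !xdist !mul1r.
have U01 i : 0 <= U (x i) w < 1.
  by apply: contrapT => wout; apply: win; exists i.
have /andP[_ U1] := U01 j; have /andP[U0 _] := U01 j.+1.
by rewrite -natr1; lra.
Qed.

(** The ray [x] ensures that the set whose infimum is taken is not empty; the
    infimum of the empty set would be 0. *)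
Lemma rmf_theta_c_ge (c : R) (x : nat -> V) :
  simple_ray e rho x -> (forall j, dist rho (x j) = j%:R) ->
  (forall theta : R, 0 <= theta <= 1 -> theta <= c ->
    {ae P, forall w, ~ rmf_percolation rho dist (simple_ray e rho) U theta w}) ->
  c <= rmf_theta_c rho dist (simple_ray e rho) U.
Proof.
move=> ex xdist subcrit; apply: lb_le_inf.
  by exists 1; split; [rewrite ler01 lexx | exact: percolation_theta1 ex xdist].
move=> theta [theta01 Ppos]; rewrite leNgt; apply/negP => /ltW /(subcrit _ theta01).
rewrite /almost_everywhere/= => null; move: Ppos.
rewrite (measure_negligible _ (negligibleS _ null)) ?ltxx//.
  exact: measurable_rmf_percolation nbrP.
by move=> w Ew /=; apply.
Qed.

End critical_value.

(** * The lattice *)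

Section lattice.
Variable n : nat.
Implicit Types (u v : 'rV[int]_n) (i : 'I_n) (b : bool).

Definition unit_step b i : 'rV[int]_n := (-1) ^+ b *: delta_mx 0 i.

Lemma unit_stepE b i i' :
  unit_step b i 0 i' = if i' == i then (-1) ^+ b else 0.
Proof. by rewrite !mxE eqxx /=; case: eqP; rewrite ?mulr1 ?mulr0. Qed.

Lemma Zn_adj_stepP u v : Zn_adj u v -> exists b i, v = u + unit_step b i.
Proof.
rewrite /Zn_adj /l1norm => /eqP sum1.
have [i ui] : exists i, (u - v) 0 i != 0.
  apply: contrapT => no_i; move: sum1; rewrite big1// => i _.
  by apply/eqP; rewrite normr_eq0; apply/negPn/negP => ui; apply: no_i; exists i.
have rest0 i' : i' != i -> (u - v) 0 i' = 0.
  move=> i'i; move: sum1; rewrite (bigD1 i)//= (bigD1 i')//=.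
  set S := \sum_(j | _) _; have : 0 <= S by apply: sumr_ge0.
  by move: ui; move: S ((u - v) 0 i) ((u - v) 0 i') => S a b; lia.
have ui1 : `|(u - v) 0 i| = 1.
  by move: sum1; rewrite (bigD1 i)//= big1 ?addr0// => j /rest0->.
exists (0 < (u - v) 0 i), i; apply/rowP => i'; rewrite mxE unit_stepE.
case: eqP => [->|/eqP/rest0]; last first.
  by rewrite !mxE; move: (u 0 i') (v 0 i') => a b; lia.
move: ui1; rewrite !mxE; move: (u 0 i) (v 0 i) => a b.
by case: ltP => /=; rewrite ?expr1 ?expr0; lia.
Qed.

Lemma l1norm_step u b i :
  l1norm (u + unit_step b i) = l1norm u - `|u 0 i| + `|u 0 i + (-1) ^+ b|.
Proof.
rewrite /l1norm (bigD1 i)//= [in RHS](bigD1 i)//= mxE unit_stepE eqxx.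
rewrite [in RHS](addrC `|u 0 i|) addrK [RHS]addrC; congr (_ + _); apply: eq_bigr.
by move=> j /negbTE ji; rewrite mxE unit_stepE ji addr0.
Qed.

Definition lattice_nbr u : seq 'rV[int]_n :=
  [seq u + unit_step b i | b <- [:: false; true], i <- enum 'I_n].

Lemma lattice_nbrP u v : Zn_adj u v -> v \in lattice_nbr u.
Proof.
move=> /Zn_adj_stepP[b [i ->]]; apply/allpairsP; exists (b, i).
by rewrite mem_enum !inE; case: b.
Qed.

Lemma size_lattice_nbr u : size (lattice_nbr u) = (2 * n)%N.
Proof. by rewrite size_allpairs size_enum_ord. Qed.

Lemma Zn_adj_sym : symmetric (@Zn_adj n).
Proof.
move=> u v; rewrite /Zn_adj /l1norm; congr (_ == _); apply: eq_bigr => i _.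
by rewrite !mxE distrC.
Qed.

Definition outward_adj : rel 'rV[int]_n :=
  fun u v => Zn_adj u v && (l1norm u < l1norm v).

(** Both families of permitted paths are thus simple rays of a locally finite
    relation, the form required by [rmf_theta_c_ge]. *)
Lemma non_backtracking_raysE :
  @non_backtracking_rays n = simple_ray outward_adj 0.
Proof.
apply/seteqP; split=> x /=.
  by move=> [[x0 xadj xinj] xl]; split=> // j; rewrite /outward_adj xadj xl.
by move=> [x0 xadj xinj]; split; [split=> // j|move=> j]; have /andP[] := xadj j.
Qed.

(** An outward step in direction [i] must increase the absolute value of the
    coordinate [i]; so it goes in the direction of the sign of that coordinate
    if the latter is not 0, and no coordinate ever changes sign. *)
Lemma outward_stepP u v : outward_adj u v ->
  exists b i, [/\ v = u + unit_step b i, 0 < (-1) ^+ b * v 0 i &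
    forall b' i', 0 < (-1) ^+ b' * u 0 i' -> 0 < (-1) ^+ b' * v 0 i'].
Proof.
move=> /andP[/Zn_adj_stepP[b [i ->]]]; rewrite l1norm_step => further.
exists b, i; split=> //.
  rewrite mxE unit_stepE eqxx; move: further; move: (l1norm u) (u 0 i) => N a.
  by case: b; rewrite ?expr1 ?expr0; lia.
move=> b' i'; rewrite mxE unit_stepE; case: eqP => [->|_]; last by rewrite addr0.
move: further; move: (l1norm u) (u 0 i) => N a.
by case: b; case: b'; rewrite ?expr1 ?expr0; lia.
Qed.

(** The signs can be read off the vertex [x k]: a coordinate modified before time
    [k] has from then on the sign of the step that modified it. *)
Lemma outward_ray_orthant (x : nat -> 'rV[int]_n) k :
  (forall j, outward_adj (x j) (x j.+1)) ->
  exists s : {ffun 'I_n -> bool}, forall j, (j < k)%N ->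
    exists i, x j.+1 = x j + unit_step (s i) i.
Proof.
move=> xout; exists [ffun i => x k 0 i < 0] => j jk.
have [b [i [xj pos _]]] := outward_stepP (xout j).
exists i; rewrite ffunE xj; congr (_ + unit_step _ _).
have {}pos : 0 < (-1) ^+ b * x k 0 i.
  rewrite -(subnK jk); elim: (k - j.+1)%N => [//|d IHd].
  have [_ [_ [_ _ keep]]] := outward_stepP (xout (d + j.+1)%N).
  by rewrite addSn; exact: keep.
move: pos; move: (x k 0 i) => a.
by case: b {xj}; rewrite ?expr1 ?expr0; case: ltP; lia.
Qed.

Lemma outward_ray_prefixes k :
  exists L : seq (seq 'rV[int]_n), size L = (2 ^ n * n ^ k)%N /\
    forall x, simple_ray outward_adj 0 x -> mkseq x k.+1 \in L.
Proof.
pose next (s : {ffun 'I_n -> bool}) u := [seq u + unit_step (s i) i | i <- enum 'I_n].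
exists [seq p | s <- enum {ffun 'I_n -> bool}, p <- walks (next s) 0 k]; split.
  rewrite size_allpairs_dep (eq_map (g := fun=> (n ^ k)%N)); last first.
    by move=> s; apply: size_walks => u; rewrite size_map size_enum_ord.
  by rewrite sumnE big_map big_enum sum_nat_const card_ffun card_bool card_ord.
move=> x [x0 xout _]; have [s xs] := outward_ray_orthant k xout.
apply/allpairsPdep; exists s, (mkseq x k.+1); rewrite mem_enum; split=> //.
rewrite -x0; apply: mem_walks => j /xs[i ->].
by apply/mapP; exists i; rewrite ?mem_enum.
Qed.

Definition axis_ray (i0 : 'I_n) (j : nat) : 'rV[int]_n := j%:Z *: delta_mx 0 i0.

Lemma axis_rayS i0 j : axis_ray i0 j.+1 = axis_ray i0 j + unit_step false i0.
Proof. by rewrite /axis_ray /unit_step expr0 -scalerDl intS addrC. Qed.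

Lemma axis_ray_coord i0 j i : axis_ray i0 j 0 i = if i == i0 then j%:Z else 0.
Proof. by rewrite !mxE eqxx /=; case: eqP; rewrite ?mulr1 ?mulr0. Qed.

Lemma axis_ray_outward i0 : simple_ray outward_adj 0 (axis_ray i0).
Proof.
split; first by rewrite /axis_ray scale0r.
  move=> j; rewrite axis_rayS /outward_adj l1norm_step axis_ray_coord eqxx expr0.
  apply/andP; split; last by lia.
  rewrite /Zn_adj opprD addrA subrr add0r -[- unit_step _ _]add0r.
  have -> : - unit_step false i0 = unit_step true i0.
    by rewrite /unit_step expr1 expr0 scaleN1r scale1r.
  rewrite l1norm_step /l1norm big1 ?mxE; first by rewrite expr1.
  by move=> i _; rewrite mxE normr0.
move=> j j' /(congr1 (fun v : 'rV_n => v 0 i0)).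
by rewrite !axis_ray_coord eqxx => -[].
Qed.

Lemma outward_simple_ray x : simple_ray outward_adj 0 x -> @all_rays n x.
Proof. by move=> [x0 xout xinj]; split=> // j; have /andP[] := xout j. Qed.

Variable R : realType.

(** The increments over unit intervals of a convex function are nondecreasing:
    [t + 1] and [N] are the two convex combinations of [t] and [N + 1] with
    weights [lam] and [1 - lam] exchanged. *)
Lemma powR_convex_incr (r t N : R) : 1 <= r -> 0 <= t -> t <= N ->
  (t + 1) `^ r + N `^ r <= t `^ r + (N + 1) `^ r.
Proof.
move=> r1 t0 tN; have D0 : 0 < N + 1 - t by lra.
pose lam := (N + 1 - t)^-1.
have lam0 : 0 <= lam by rewrite invr_ge0 ltW.
have lam1 : lam <= 1 by rewrite invf_le1//; lra.
have lamE : lam * (N + 1 - t) = 1 by rewrite mulVf ?gt_eqF.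
have conv := convex_powR r1 (Itv01 lam0 lam1).
have dom s : 0 <= s -> s \in (`[0, +oo[%classic : set R).
  by move=> s0; rewrite inE/= in_itv/= s0.
have N0 : 0 <= N + 1 by lra.
have {}conv (a c : R) : 0 <= a -> 0 <= c ->
    (lam * a + (1 - lam) * c) `^ r <= lam * a `^ r + (1 - lam) * c `^ r.
  move=> a0 c0; have := conv _ _ (dom _ a0) (dom _ c0).
  by rewrite [leRHS]convRE [X in X `^ _ <= _]convRE.
have := conv _ _ t0 N0; have := conv _ _ N0 t0.
rewrite (_ : lam * (N + 1) + (1 - lam) * t = t + 1); last by move: lamE; lra.
rewrite (_ : lam * t + (1 - lam) * (N + 1) = N); last by move: lamE; lra.
lra.
Qed.

(** Minkowski's inequality for a unit step.  With [N] the norm of [u], [t] the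
    absolute value of the coordinate that changes and [S] the contribution of
    the others, it reduces to [S + (t + 1) ^ r <= (N + 1) ^ r] where
    [N ^ r = S + t ^ r], an instance of [powR_convex_incr] since [t <= N]. *)
Lemma lq_norm_step (q : \bar R) u b i : (1 <= q)%E ->
  lq_norm q (u + unit_step b i) <= lq_norm q u + 1.
Proof.
have le1 j : `|((u + unit_step b i) 0 j)%:~R : R| <= `|(u 0 j)%:~R| + 1.
  rewrite mxE unit_stepE intrD; apply: le_trans (ler_normD _ _) _; rewrite lerD2l.
  by case: eqP => _; rewrite ?normr0// rmorphXn rmorphN1 normrX normrN1 expr1n.
case: q => [r||//] q1 /=; last first.
  apply: bigmax_le => [|j _]; first by rewrite addr_ge0// bigmax_ge_id.
  by apply: le_trans (le1 j) _; rewrite lerD2r; exact: le_bigmax.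
rewrite lee_fin in q1; have r0 : 0 < r by lra.
set A := \sum_(j < n) `|(u 0 j)%:~R : R| `^ r.
have A0 : 0 <= A by apply: sumr_ge0 => j _; exact: powR_ge0.
set N := A `^ r^-1; have N0 : 0 <= N by exact: powR_ge0.
have Nr : N `^ r = A by rewrite -powRrM mulVf ?gt_eqF// powRr1.
have rootK x : 0 <= x -> (x `^ r) `^ r^-1 = x.
  by move=> x0; rewrite -powRrM mulfV ?gt_eqF// powRr1.
rewrite -[leRHS]rootK ?addr_ge0//; apply: ge0_ler_powR.
- by rewrite invr_ge0 ltW.
- by rewrite nnegrE; apply: sumr_ge0 => j _; exact: powR_ge0.
- by rewrite nnegrE powR_ge0.
set t : R := `|(u 0 i)%:~R|; set S := \sum_(j < n | j != i) `|(u 0 j)%:~R : R| `^ r.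
have AE : A = t `^ r + S by rewrite /A (bigD1 i).
have t0 : 0 <= t by exact: normr_ge0.
have tN : t <= N.
  rewrite -[t]rootK// /N; apply: ge0_ler_powR; rewrite ?nnegrE ?powR_ge0//.
    by rewrite invr_ge0 ltW.
  by rewrite AE lerDl; apply: sumr_ge0 => j _; exact: powR_ge0.
have := powR_convex_incr q1 t0 tN; rewrite Nr {1}AE => conv.
rewrite (bigD1 i)//= (eq_bigr (fun j => `|(u 0 j)%:~R : R| `^ r)); last first.
  by move=> j /negbTE ji; rewrite mxE unit_stepE ji addr0.
rewrite -/S; have := ge0_ler_powR (ltW r0) _ _ (le1 i).
by rewrite !nnegrE addr_ge0// => /(_ (normr_ge0 _) isT); rewrite -/t; lra.
Qed.

Lemma lq_dist_step (q : \bar R) u v : (1 <= q)%E -> Zn_adj u v ->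
  lq_dist q 0 v <= lq_dist q 0 u + 1.
Proof.
move=> q1 /Zn_adj_stepP[b [i ->]]; rewrite /lq_dist !sub0r opprD.
have -> : - unit_step b i = unit_step (~~ b) i.
  by rewrite /unit_step signrN scaleNr.
exact: lq_norm_step.
Qed.

Lemma lq_dist_axis (q : \bar R) (i0 : 'I_n) j : (1 <= q)%E ->
  lq_dist q 0 (axis_ray i0 j) = j%:R.
Proof.
have coord i : `|((0 - axis_ray i0 j) 0 i)%:~R : R| = if i == i0 then j%:R else 0.
  rewrite sub0r mxE axis_ray_coord; case: eqP => _; last by rewrite oppr0 normr0.
  by rewrite mulrNz normrN -pmulrn normr_nat.
case: q => [r||//] q1; rewrite /lq_dist /lq_norm.
  rewrite lee_fin in q1; have r0 : r != 0 by lra.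
  rewrite (bigD1 i0)//= big1; last by move=> i /negbTE ii0; rewrite coord ii0 powR0.
  by rewrite coord eqxx addr0 -powRrM mulfV// powRr1.
apply/eqP; rewrite eq_le; apply/andP; split.
  by apply: bigmax_le => // i _; rewrite coord; case: eqP.
by apply: (le_trans _ (le_bigmax _ _ i0)); rewrite coord eqxx.
Qed.

End lattice.

(** * The theorem *)

Theorem proposition1p12 (R : realType) (dsp : measure_display)
    (Omega : measurableType dsp) (P : probability Omega R) :
  (forall (V : metricType R) (adj : rel V) (rho : V) (Delta : nat)
      (U : V -> {RV P >-> R}) (theta : R),
    connected_graph adj ->
    has_max_degree adj Delta ->
    (2 <= Delta)%N ->
    (forall u v : V, adj u v -> mdist u v <= 1) ->
    iid_uniform01 U ->
    0 <= theta <= 1 ->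
    theta <= 1 / ((Delta%:R - 1) * expR 1) ->
    {ae P, forall w,
      ~ rmf_percolation rho mdist (simple_ray adj rho) U theta w})
  /\
  (forall (n : nat) (q : \bar R) (U : 'rV[int]_n -> {RV P >-> R}),
    (2 <= n)%N ->
    (1 <= q)%E ->
    iid_uniform01 U ->
    [/\ forall theta : R, 0 <= theta <= 1 ->
          theta <= 1 / (n%:R * expR 1) ->
          {ae P, forall w,
            ~ rmf_percolation 0 (lq_dist q) (@non_backtracking_rays n) U theta w},
        forall theta : R, 0 <= theta <= 1 ->
          theta <= 1 / ((2 * n%:R - 1) * expR 1) ->
          {ae P, forall w,
            ~ rmf_percolation 0 (lq_dist q) (@all_rays n) U theta w},
        1 / (n%:R * expR 1)
          <= rmf_theta_c 0 (lq_dist q) (@non_backtracking_rays n) U &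
        1 / ((2 * n%:R - 1) * expR 1)
          <= rmf_theta_c 0 (lq_dist q) (@all_rays n) U]).
Proof.
split=> [V adj rho Delta U theta [adj_sym _ _] [deg _] Delta2 dist1 iidU|].
  move=> /andP[theta0 _] thetac.
  have finite_nbr v : finite_set [set u | adj v u].
    by apply/finite_set_leP; exists Delta.
  pose nbr v : seq V := fset_set [set u | adj v u].
  have nbrP u v : adj u v -> v \in nbr u.
    by move=> uv; rewrite in_fset_set// inE.
  apply: (ae_no_percolation_of_degree iidU adj_sym Delta2 nbrP) => //.
  - by move=> v; exact: geq_card_fset_set.
  - move=> u v /dist1 uv; apply: le_trans (metric_triangle rho u v) _.
    by rewrite lerD2l.
move=> n q U n2 q1 iidU.
have n0 : (0 < n)%N by exact: ltnW.
have outward_nbr (u v : 'rV[int]_n) : outward_adj u v -> v \in lattice_nbr u.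
  by move=> /andP[/lattice_nbrP].
have dist_axis j := lq_dist_axis (Ordinal n0) j q1.
have outward_ray := axis_ray_outward (Ordinal n0).
have nb_subcrit (theta : R) : 0 <= theta <= 1 -> theta <= 1 / (n%:R * expR 1) ->
    {ae P, forall w,
      ~ rmf_percolation 0 (lq_dist q) (simple_ray (@outward_adj n) 0) U theta w}.
  move=> /andP[theta0 _] thetac.
  apply: (ae_no_percolation (C := 2 ^+ n) (D := n%:R)) => //.
  - by rewrite ltr0n.
  - by move=> x [].
  - by move=> x j [_ /(_ j)/andP[xj _] _]; exact: lq_dist_step.
  move=> k; have [L [sizeL LP]] := outward_ray_prefixes n k.
  by exists L; rewrite sizeL natrM !natrX.
have all_subcrit (theta : R) : 0 <= theta <= 1 ->
    theta <= 1 / ((2 * n%:R - 1) * expR 1) ->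
    {ae P, forall w, ~ rmf_percolation 0 (lq_dist q) (@all_rays n) U theta w}.
  move=> /andP[theta0 _]; rewrite -natrM => thetac.
  apply: (ae_no_percolation_of_degree iidU (@Zn_adj_sym n) _
            (@lattice_nbrP n)) thetac => //.
  - lia.
  - by move=> v; rewrite size_lattice_nbr.
  - by move=> u v uv; exact: lq_dist_step.
rewrite non_backtracking_raysE; split=> //.
- refine (rmf_theta_c_ge iidU outward_nbr outward_ray dist_axis nb_subcrit).
- refine (rmf_theta_c_ge iidU (@lattice_nbrP n) _ dist_axis all_subcrit).
  exact: outward_simple_ray outward_ray.
Qed.
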